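(* Let $\Omega$ be an alphabet with $b\geq 2$ symbols and let $x\in\Omega^{\mathbb{N}}$. Fix a positive real number $\lambda$ and define, for every $i\in\mathbb{N}_0$, $p_i=\liminf_{k\to\infty}Z^\lambda_{i,k}(x)$. If $\sum_{i\geq 0} i\,p_i=\lambda$, then $x$ is Borel normal to base $b$.
   Context: Positions in sequences are numbered from $1$; $x[i\dots j]$ is the subword from position $i$ to $j$. For words $v,w$, $|v|_w=\#\{1\leq i\leq |v|-|w|+1 : v[i\dots i+|w|-1]=w\}$. For $x\in\Omega^{\mathbb{N}}$, $\lambda>0$, $i\in\mathbb{N}_0$, $k\in\mathbb{N}$, $Z^\lambda_{i,k}(x)=b^{-k}\,\#\{w\in\Omega^k : |x[1\dots\lfloor\lambda b^k\rfloor+k-1]|_w=i\}$. A sequence $x\in\Omega^{\mathbb{N}}$ is Borel normal (to base $b$) if for every finite word $w$ over $\Omega$, $\lim_{n\to\infty}|x[1\dots n]|_w/n=b^{-|w|}$. *)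

(* Defs.v *)
From HB Require Import structures.
From mathcomp Require Import all_boot all_order all_algebra.
From mathcomp Require Import all_classical all_reals all_analysis.
Set Implicit Arguments. Unset Strict Implicit. Unset Printing Implicit Defensive.
Import Order.TTheory GRing.Theory Num.Theory.
Local Open Scope ring_scope.
Local Open Scope classical_set_scope.

(* Sequences x : nat -> Omega are indexed from 0: x 0 is the paper's x_1.
   [prefix x n] is the word x[1..n] (of length n). *)
Definition prefix (Omega : Type) (x : nat -> Omega) (n : nat) : seq Omega :=
  mkseq x n.

(* |v|_w : number of positions 1 <= i <= |v|-|w|+1 (here 0-based) with
   v[i..i+|w|-1] = w.  The range is empty when |w| > |v|. *)
Definition occ (Omega : eqType) (v w : seq Omega) : nat :=
  count (fun i => take (size w) (drop i v) == w) (iota 0 ((size v).+1 - size w)).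

Definition Zlk (R : realType) (Omega : finType) (x : nat -> Omega)
    (lambda : R) (i k : nat) : R :=
  let b := #|Omega| in
  let N := (Num.truncn (lambda * (b%:R ^+ k)) + k - 1)%N in
  #|[set w : k.-tuple Omega | occ (prefix x N) (val w) == i]|%:R / (b%:R ^+ k).

(* p_i = liminf_{k -> oo} Z^lambda_{i,k}(x)  (the sequence lies in [0,1]). *)
Definition p_lim (R : realType) (Omega : finType) (x : nat -> Omega)
    (lambda : R) (i : nat) : R :=
  limn_inf (fun k => Zlk x lambda i k).

Definition borel_normal (R : realType) (Omega : finType) (x : nat -> Omega) : Prop :=
  forall w : seq Omega,
    (fun n : nat => (occ (prefix x n) w)%:R / (n%:R : R)) @ \oo
      --> (((#|Omega|%:R : R) ^- size w) : R^o).

(* Main.v *)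
(* Let [b = #|Omega|] and [M k = floor (lambda * b ^ k)].  The words of length
   [k] occupy [M k <= lambda * b ^ k] positions in total, so the equality
   [\sum_i i * p_i = lambda] forbids any loss of mass: for some [I], words
   occurring more than [I] times cover an arbitrarily small fraction of the
   positions, uniformly in large [k].  By a second moment bound, all but a small
   proportion of the words of length [k] contain disjoint blocks equal to [w]
   with frequency close to [b ^- size w]; the exceptional words occurring at most
   [I] times also cover few positions.  Averaging over the windows of length [k]
   that start before [n], for the first [k] with [n <= M k], gives the
   frequency of [w] in the prefix of length [n], as [n] and [b ^ k] are then of
   the same order. *)

Require Import Defs.
From HB Require Import structures.
From mathcomp Require Import all_boot all_order all_algebra.
From mathcomp Require Import all_classical all_reals all_analysis.
From mathcomp Require Import zify ring lra.
Import Order.TTheory GRing.Theory Num.Theory.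
Local Open Scope ring_scope.
Local Open Scope classical_set_scope.

(** * Sums over all words of a given length *)

(** Recursion on the length keeps words as plain sequences, so that splitting a word into two pieces
    needs no casts between tuple types. *)
Fixpoint wsum {R : realType} {Omega : finType} (n : nat) (G : seq Omega -> R) : R :=
  if n is m.+1 then \sum_a wsum m (fun v => G (a :: v)) else G [::].

Lemma wsumE {R : realType} {Omega : finType} n (G : seq Omega -> R) :
  wsum n G = \sum_(v : n.-tuple Omega) G v.
Proof.
elim: n G => [|n IH] G /=.
  rewrite (eq_bigl (pred1 [tuple])) ?big_pred1_eq// => v.
  by rewrite [v]tuple0 /= eqxx.
rewrite (eq_bigr (fun a => \sum_(v : n.-tuple Omega) G (a :: v))); last first.
  by move=> a _; rewrite IH.
rewrite pair_big /=.
rewrite [RHS](reindex (fun p : Omega * n.-tuple Omega => [tuple of p.1 :: p.2])) //=.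
exists (fun v : n.+1.-tuple Omega => (thead v, [tuple of behead v])) => [[a v] _|v _] /=.
  by rewrite theadE; congr pair; apply: val_inj.
by rewrite [RHS]tuple_eta.
Qed.

Lemma eq_wsum {R : realType} {Omega : finType} n (G H : seq Omega -> R) :
  (forall v, size v = n -> G v = H v) -> wsum n G = wsum n H.
Proof. by move=> GH; rewrite !wsumE; apply: eq_bigr => v _; rewrite GH ?size_tuple. Qed.

Lemma wsum_cat {R : realType} {Omega : finType} m n (G : seq Omega -> R) :
  wsum (m + n) G = wsum m (fun u => wsum n (fun v => G (u ++ v))).
Proof.
by elim: m G => [//|m IH] G /=; apply: eq_bigr => a _; rewrite IH.
Qed.

Lemma wsumD {R : realType} {Omega : finType} n (G H : seq Omega -> R) :
  wsum n (fun v => G v + H v) = wsum n G + wsum n H.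
Proof. by rewrite !wsumE big_split. Qed.

Lemma wsumZ {R : realType} {Omega : finType} n (c : R) (G : seq Omega -> R) :
  wsum n (fun v => c * G v) = c * wsum n G.
Proof. by rewrite !wsumE mulr_sumr. Qed.

Lemma le_wsum {R : realType} {Omega : finType} n (G H : seq Omega -> R) :
  (forall v, size v = n -> G v <= H v) -> wsum n G <= wsum n H.
Proof. by move=> GH; rewrite !wsumE; apply: ler_sum => v _; rewrite GH ?size_tuple. Qed.

Lemma wsum_cst {R : realType} {Omega : finType} n (c : R) :
  wsum n (fun _ : seq Omega => c) = #|Omega|%:R ^+ n * c.
Proof. by rewrite wsumE sumr_const card_tuple -natrX mulr_natl. Qed.

Lemma wsum_pred1 {R : realType} {Omega : finType} (w : seq Omega) :
  wsum (size w) (fun v => (v == w)%:R : R) = 1.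
Proof.
rewrite wsumE (bigD1 (in_tuple w)) //= eqxx big1 ?addr0 // => v /negbTE vw.
by rewrite (_ : (_ == _) = (v == in_tuple w)) ?vw.
Qed.

(* Spacing the inspected blocks [size w + 1] apart keeps them disjoint, hence
   independent for the uniform measure, also when [w] is empty. *)
Fixpoint blockdev {R : realType} {Omega : finType} (w : seq Omega) (T : nat)
    (v : seq Omega) : R :=
  if T is T'.+1 then
    (take (size w) v == w)%:R - #|Omega|%:R ^- size w +
      blockdev w T' (drop (size w).+1 v)
  else 0.

(** * Moments of the block deviation over all words of a given length *)

Section Moments.
Context {R : realType} {Omega : finType} (b_ge2 : (2 <= #|Omega|)%N) (w : seq Omega).
Let b : R := #|Omega|%:R.
Let q : R := b ^- size w.
Let L := (size w).+1.
Let a (v : seq Omega) : R := (take (size w) v == w)%:R - q.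

Let b_gt0 : 0 < b.
Proof. by rewrite ltr0n; lia. Qed.

Let q_itv : 0 <= q <= 1.
Proof.
rewrite /q invr_ge0 (exprn_ge0 _ (ltW b_gt0)) /= invf_le1 ?exprn_gt0//.
by rewrite exprn_ege1// ler1n; lia.
Qed.

Let a_le1 v : `|a v| <= 1.
Proof.
rewrite /a ler_norml; move: q_itv; case: (_ == _) => /=; lra.
Qed.

Let wsum_a : wsum L a = 0.
Proof.
(* The spacer letter after the inspected block contributes only a factor [b]. *)
rewrite /L -addn1 wsum_cat /a.
rewrite (eq_wsum _ _ (fun u => b * ((u == w)%:R - q))); last first.
  move=> u su; rewrite (eq_wsum _ _ (fun _ => (u == w)%:R - q)) ?wsum_cst ?expr1//.
  by move=> v sv; rewrite -su take_size_cat.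
rewrite wsumZ wsumD wsum_pred1 wsum_cst -/b mulrN /q mulfV ?subrr ?mulr0//.
by rewrite expf_neq0 ?lt0r_neq0.
Qed.

Lemma blockdev_cat T u v : size u = L ->
  blockdev w T.+1 (u ++ v) = a u + blockdev w T v.
Proof.
move=> su /=; rewrite -/b -/q -/L drop_size_cat// /a takel_cat//.
by rewrite su.
Qed.

Lemma wsum_blockdev T r : wsum (L * T + r) (blockdev w T) = 0 :> R.
Proof.
elim: T => [|T IH]; first by rewrite muln0 wsum_cst mulr0.
rewrite mulnS -addnA wsum_cat.
rewrite (eq_wsum _ _ (fun u => b ^+ (L * T + r) * a u)) ?wsumZ ?wsum_a ?mulr0// => u su.
under eq_wsum => v _ do rewrite blockdev_cat//.
by rewrite wsumD wsum_cst IH addr0.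
Qed.

(** Peeling off the first block leaves a cross term that vanishes, since the remaining blocks have
    mean zero by [wsum_blockdev]. Hence variances add, each block contributing at most the number of
    words. *)
Lemma wsum_blockdev_sqr T r :
  wsum (L * T + r) (fun v => blockdev w T v ^+ 2) <= T%:R * b ^+ (L * T + r).
Proof.
elim: T => [|T IH].
  by rewrite muln0 mul0r /= wsum_cst expr0n mulr0.
rewrite mulnS -addnA wsum_cat; set K := (L * T + r)%N.
rewrite (eq_wsum _ _ (fun u => b ^+ K * a u ^+ 2 +
    wsum K (fun v => blockdev w T v ^+ 2))); last first.
  move=> u su.
  under eq_wsum => v _ do
    rewrite blockdev_cat// sqrrD addrAC -mulr_natl mulrA.
  by rewrite wsumD wsumZ wsum_blockdev mulr0 addr0 wsumD wsum_cst.
rewrite wsumD wsumZ wsum_cst -/b exprD -natr1 mulrDl mul1r addrC.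
have a2 : wsum L (fun u => a u ^+ 2) <= b ^+ L.
  rewrite -[leRHS]mulr1 -[leRHS]wsum_cst; apply: le_wsum => v _.
  by rewrite -real_normK ?num_real// expr_le1.
apply: lerD; last by rewrite mulrC ler_wpM2r// exprn_ge0 ?ltW.
by rewrite mulrCA ler_wpM2l// exprn_ge0 ?ltW.
Qed.

(* AM-GM turns the second moment into a bound on the first absolute moment. *)
Lemma wsum_blockdev_norm T r (d : R) : (0 < T)%N -> 0 < d ->
  wsum (L * T + r) (fun v => `|blockdev w T v|) <=
    T%:R * b ^+ (L * T + r) * (d + (d * T%:R)^-1).
Proof.
move=> T0 d0; have T0' : 0 < T%:R :> R by rewrite ltr0n.
set c := (d * T%:R)^-1; have c0 : 0 < c by rewrite invr_gt0 mulr_gt0.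
apply: (@le_trans _ _ (wsum (L * T + r)
    (fun v => d * T%:R + c * blockdev w T v ^+ 2))).
  apply: le_wsum => v _; rewrite -[_ ^+ 2]real_normK ?num_real//.
  set y := `|_|; have y0 : 0 <= y by exact: normr_ge0.
  have dT : d * T%:R * c = 1 by rewrite mulfV// lt0r_neq0// mulr_gt0.
  (* Completing the square, with [d * T%:R * c = 1]. *)
  have E : d * T%:R + c * y ^+ 2 - y = c * (y - d * T%:R) ^+ 2 + y.
    rewrite (_ : c * (_ - _) ^+ 2 = c * y ^+ 2 - (d * T%:R * c) * y *+ 2
      + d * T%:R * c * (d * T%:R)); last by ring.
    by rewrite dT; ring.
  rewrite -subr_ge0 E.
  by rewrite addr_ge0// mulr_ge0 ?sqr_ge0// ltW.
rewrite wsumD wsum_cst wsumZ -/b.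
have := wsum_blockdev_sqr T r; set S := wsum _ _ => HS.
have : c * S <= c * (T%:R * b ^+ (L * T + r)) by rewrite ler_wpM2l// ltW.
lra.
Qed.

Lemma blockdev_le T v : `|blockdev w T v : R| <= T%:R.
Proof.
elim: T v => [|T IH] v; first by rewrite normr0.
rewrite (le_trans (ler_normD _ _))// -nat1r lerD// ?IH//.
exact: a_le1.
Qed.
End Moments.

(** * Windows of the sequence *)

Definition window {Omega : Type} (x : nat -> Omega) (j k : nat) : seq Omega :=
  mkseq (fun i => x (j + i)%N) k.

Lemma size_window {Omega : Type} (x : nat -> Omega) j k : size (window x j k) = k.
Proof. exact: size_mkseq. Qed.

Lemma drop_window {Omega : Type} (x : nat -> Omega) j k s :
  drop s (window x j k) = window x (j + s) (k - s).
Proof.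
rewrite /window /mkseq -map_drop drop_iota add0n -[s in iota s _]addn0 iotaDl.
by rewrite -map_comp; apply: eq_map => i /=; rewrite addnA.
Qed.

Lemma take_window {Omega : Type} (x : nat -> Omega) j k l : (l <= k)%N ->
  take l (window x j k) = window x j l.
Proof. by move=> lk; rewrite /window /mkseq -map_take take_iota (minn_idPl lk). Qed.

Lemma occ_prefix {Omega : eqType} (x : nat -> Omega) n (w : seq Omega) :
  occ (Defs.prefix x n) w = (\sum_(j < n.+1 - size w) (window x j (size w) == w))%N.
Proof.
rewrite /occ size_mkseq -sum1_count -(big_mkord predT
  (fun j => (window x j (size w) == w) : nat)) /index_iota subn0 big_mkcond /=.
rewrite big_seq [RHS]big_seq; apply: eq_bigr => j; rewrite mem_iota => /andP[_ jn].
rewrite (_ : Defs.prefix x n = window x 0 n) // drop_window add0n take_window; last lia.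
by case: (_ == _).
Qed.

Lemma blockdev_window {R : realType} {Omega : finType} (x : nat -> Omega)
    (w : seq Omega) T j k : ((size w).+1 * T <= k)%N ->
  blockdev w T (window x j k) =
  \sum_(t < T) ((window x (j + (size w).+1 * t) (size w) == w)%:R
    - #|Omega|%:R ^- size w) :> R.
Proof.
elim: T j k => [|T IH] j k Tk; first by rewrite big_ord0.
rewrite big_ord_recl /= muln0 addn0 take_window; last lia.
rewrite drop_window IH; last lia.
congr (_ + _); apply: eq_bigr => t _.
by rewrite /bump /= add1n mulnS addnA.
Qed.

(** Each unit shift gains one term and loses one, and two values of [h] differ by at most 1. *)
Lemma sum_shift_le {R : realType} (h : nat -> R) n s :
  (forall i j, `|h i - h j| <= 1) ->
  `|\sum_(j < n) h (j + s)%N - \sum_(j < n) h j| <= s%:R.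
Proof.
move=> h1; elim: s => [|s IH].
  rewrite (eq_bigr (fun j : 'I_n => h j)) ?subrr ?normr0// => j _.
  by rewrite addn0.
have E : \sum_(j < n) h (j + s.+1)%N =
    \sum_(j < n) h (j + s)%N + (h (n + s)%N - h s).
  have := erefl (\sum_(j < n.+1) h (j + s)%N).
  rewrite {1}big_ord_recr big_ord_recl /= add0n => E.
  rewrite (eq_bigr (fun j : 'I_n => h (bump 0 j + s)%N)); last first.
    by move=> j _; rewrite /bump /= add1n addnS.
  lra.
rewrite E addrAC (le_trans (ler_normD _ _))// -natr1 lerD//.
Qed.

(** * Double counting of words and positions *)

Section Counting.
Context {R : realType} {Omega : finType} (x : nat -> Omega).

(** A prefix of length [M + k - 1] has exactly [M] starting positions for words of length [k]; these
    are grouped by the word read there. *)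
Lemma sum_window (k M : nat) (G : seq Omega -> R) : (0 < k)%N ->
  \sum_(j < M) G (window x j k) =
  wsum k (fun v => (occ (Defs.prefix x (M + k - 1)) v)%:R * G v).
Proof.
move=> k0.
rewrite wsumE.
under [RHS]eq_bigr => v _.
  rewrite occ_prefix size_tuple (_ : ((M + k - 1).+1 - k)%N = M); last lia.
  rewrite natr_sum mulr_suml; over.
rewrite exchange_big /=; apply: eq_bigr => j _.
have sw : size (window x j k) == k by rewrite size_window.
rewrite (bigD1 (Tuple sw)) //= eqxx mul1r big1 ?addr0 // => v vj.
rewrite (_ : (_ == _) = (Tuple sw == v)) // eq_sym (negbTE vj) mul0r//.
Qed.

(** Up to the factor [b ^ k], [Zlk] counts the words with exactly [i] occurrences, so the weight [i]
    turns words into the positions they cover. *)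
Lemma sum_Zlk (lambda : R) (I k : nat) : (0 < #|Omega|)%N ->
  #|Omega|%:R ^+ k * (\sum_(i < I) i%:R * Zlk x lambda i k) =
  wsum k (fun v =>
    let c := occ (Defs.prefix x (Num.truncn (lambda * #|Omega|%:R ^+ k) + k - 1)) v in
    c%:R * (c < I)%:R).
Proof.
move=> b0; rewrite /Zlk; set N := (_ + k - 1)%N.
have bk : #|Omega|%:R ^+ k != 0 :> R.
  by rewrite expf_neq0// pnatr_eq0; lia.
rewrite wsumE /= mulr_sumr.
rewrite (eq_bigr (fun i : 'I_I => \sum_(v : k.-tuple Omega)
    i%:R * (occ (Defs.prefix x N) v == i)%:R)); last first.
  move=> i _; rewrite mulrCA [X in _ * X]mulrC divfK// -mulr_sumr; congr (_ * _).
  rewrite -sum1_card natr_sum big_mkcond; apply: eq_bigr => v _.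
  rewrite (_ : (v \in _) = (occ (Defs.prefix x N) v == i)); last exact: asboolb.
  by case: (_ == _).
rewrite exchange_big /=; apply: eq_bigr => v _; set c := occ _ _.
case: (ltnP c I) => cI; last first.
  rewrite mulr0 big1// => i _; case: eqP => [E|]; last by rewrite mulr0.
  by have := ltn_ord i; lia.
rewrite (bigD1 (Ordinal cI)) //= eqxx big1 ?addr0// => i; rewrite -val_eqE /=.
by move=> /negbTE ic; rewrite eq_sym ic mulr0.
Qed.

Lemma Zlk_itv (lambda : R) i k : (0 < #|Omega|)%N -> 0 <= Zlk x lambda i k <= 1.
Proof.
move=> b0; have bk : 0 < #|Omega|%:R ^+ k :> R by rewrite exprn_gt0// ltr0n.
apply/andP; split; rewrite /Zlk.
  by rewrite divr_ge0// ltW.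
rewrite ler_pdivrMr// mul1r -natrX ler_nat.
by rewrite -card_tuple max_card.
Qed.

End Counting.

(** * Eventual lower bounds from lower limits *)

Lemma limn_inf_near_lt {R : realType} (u : nat -> R) (a : R) :
  has_ubound (range u) -> has_lbound (range u) ->
  a < limn_inf u -> \forall n \near \oo, a < u n.
Proof.
move=> u_ub u_lb; rewrite /limn_inf (cvg_lim _ (cvg_infs_sup u_ub u_lb))// => au.
have [|_ [m _ <-] am] := sup_gt _ au; first by exists (infs u 0); exists 0%N.
exists m => // n /= mn; rewrite (lt_le_trans am)//.
by apply: ge_inf; [exact: has_lbound_sdrop|exists n].
Qed.

Lemma sum_Zlk_near {R : realType} {Omega : finType} (x : nat -> Omega)
    (lambda : R) (I : nat) (e : R) : (0 < #|Omega|)%N -> 0 < e ->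
  \forall k \near \oo, \sum_(i < I) i%:R * p_lim x lambda i - e <
                       \sum_(i < I) i%:R * Zlk x lambda i k.
Proof.
move=> b0; elim: I e => [|I IH] e e0.
  by apply: nearW => k; rewrite !big_ord0; lra.
have e2 : 0 < e / 2 by rewrite divr_gt0.
(* The slack of the last term gets multiplied by [I]; dividing by [I.+1] also covers [I = 0]. *)
have d0 : 0 < e / 2 / I.+1%:R by rewrite divr_gt0// ltr0n.
have Zb := fun k => Zlk_itv x lambda I k b0.
have H : \forall k \near \oo,
    p_lim x lambda I - e / 2 / I.+1%:R < Zlk x lambda I k.
  apply: limn_inf_near_lt; last by rewrite ltrBlDr ltrDl.
  - by exists 1 => _ [k _ <-]; case/andP: (Zb k).
  - by exists 0 => _ [k _ <-]; case/andP: (Zb k).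
near=> k; rewrite !big_ord_recr /=.
have K1 : \sum_(i < I) i%:R * p_lim x lambda i - e / 2 <
  \sum_(i < I) i%:R * Zlk x lambda i k by near: k; exact: IH.
have K2 : p_lim x lambda I - e / 2 / I.+1%:R < Zlk x lambda I k by near: k.
have K3 : I%:R * (p_lim x lambda I - e / 2 / I.+1%:R) <= I%:R * Zlk x lambda I k.
  by rewrite ler_wpM2l// ltW.
have K4 : I%:R * (e / 2 / I.+1%:R) <= e / 2.
  by rewrite mulrCA ger_pMr// ler_pdivrMr ?ltr0n// mul1r ler_nat.
rewrite mulrBr in K3; set y := I%:R * (e / 2 / _) in K3 K4; lra.
Unshelve. all: by end_near. Qed.

(** Makes [k] negligible against [b ^+ k]. The induction starts at 3, where [2 * k + 1 <= k * k]
    begins to hold. *)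
Lemma leq_sqr_exp2 k : (k * k <= 2 * 2 ^ k)%N.
Proof.
case: (ltnP k 3) => [|k3]; first by case: k => [|[|[|]]].
elim: k k3 => // k IH; rewrite leq_eqVlt => /orP[/eqP<-//|k3].
rewrite ltnS in k3; have := IH k3; rewrite expnS; nia.
Qed.

(** * From conservation of mass to the hits of a word *)

Section Deviation.
Context {R : realType} {Omega : finType} (x : nat -> Omega) (lambda : R).
Context (b_ge2 : (2 <= #|Omega|)%N) (lambda_gt0 : 0 < lambda).
Context (p_sum : series (fun i : nat => i%:R * p_lim x lambda i) @ \oo
                 --> (lambda : R^o)).
Let b : R := #|Omega|%:R.
Let M k := Num.truncn (lambda * b ^+ k).
Let c k v := occ (Defs.prefix x (M k + k - 1)) v.

Let b_gt0 : 0 < b.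
Proof. by rewrite ltr0n; lia. Qed.

Let bX_gt0 k : 0 < b ^+ k.
Proof. exact: exprn_gt0. Qed.

Let bX_ge2X k : (2 ^ k)%:R <= b ^+ k.
Proof. by rewrite natrX lerXn2r ?nnegrE ?ler_nat. Qed.

(* No mass escapes: the words counted by [p_i], [i < I], already cover almost
   [lambda * b ^+ k] positions. *)
Lemma tight_occ (e : R) : 0 < e -> exists I : nat, \forall k \near \oo,
  wsum k (fun v => (c k v)%:R * (I <= c k v)%:R) <= e * b ^+ k.
Proof.
move=> e0; have e2 : 0 < e / 2 by rewrite divr_gt0.
have [I _ /(_ I (leqnn _)) HI] :
    \forall n \near \oo, lambda - e / 2 <
      series (fun i : nat => i%:R * p_lim x lambda i) n.
  by apply: (cvgr_gt lambda p_sum); rewrite ltrBlDr ltrDl.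
rewrite /series /= big_mkord in HI; exists I.
have H0 : (0 < #|Omega|)%N by lia.
near=> k.
have k0 : (0 < k)%N by near: k; exists 1%N.
have HZ : \sum_(i < I) i%:R * p_lim x lambda i - e / 2 <
    \sum_(i < I) i%:R * Zlk x lambda i k.
  by near: k; exact: sum_Zlk_near.
have HS := sum_Zlk x lambda I k H0; rewrite /= -/b -/(M k) in HS.
(* All words together cover exactly [M k] positions, so what the rare words leave over is small. *)
have HM : wsum k (fun v => (c k v)%:R : R) <= lambda * b ^+ k.
  have := sum_window x k (M k) (fun _ => 1 : R) k0.
  under eq_wsum => v _ do rewrite mulr1.
  rewrite sumr_const card_ord => <-.
  by rewrite truncn_le mulr_ge0// ltW.
have HD : wsum k (fun v => (c k v)%:R : R) =
    wsum k (fun v => (c k v)%:R * (c k v < I)%:R) +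
    wsum k (fun v => (c k v)%:R * (I <= c k v)%:R).
  rewrite -wsumD; apply: eq_wsum => v _.
  by case: (leqP I (c k v)) => _ /=; ring.
rewrite HD -HS in HM.
have := bX_gt0 k; set S := \sum_(i < I) _ * Zlk _ _ _ _ in HZ HM *.
set B := b ^+ k in HM * => B0.
have : (lambda - e) * B <= S * B by rewrite ler_wpM2r ?ltW//; lra.
lra.
Unshelve. all: by end_near. Qed.

(** Words are split at [I] occurrences: the frequent ones cover few positions and deviate by at most
    [T]; the others weigh at most [I] each, so the first absolute moment bounds them. *)
Lemma window_blockdev_small (w : seq Omega) (e : R) : 0 < e ->
  \forall k \near \oo,
    \sum_(j < M k) `|blockdev w (k %/ (size w).+1) (window x j k)| <=
      e * (k %/ (size w).+1)%:R * b ^+ k.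
Proof.
move=> e0; have e4 : 0 < e / 2 by rewrite divr_gt0.
have [I HI] := tight_occ _ e4.
(* [d] gives [I%:R * d <= e / 4], and [C < T] gives [I%:R / (d * T%:R) <= e / 4]. *)
set d := e / 4 / I.+1%:R.
have d0 : 0 < d by rewrite !divr_gt0 ?ltr0n.
set C := Num.truncn (I.+1%:R / (d * (e / 4))).
near=> k; set T := (k %/ _)%N.
have HIk : wsum k (fun v => (c k v)%:R * (I <= c k v)%:R) <= e / 2 * b ^+ k.
  by near: k.
have kC : ((size w).+1 * C.+1 <= k)%N by near: k; exists ((size w).+1 * C.+1)%N.
have TC : (C < T)%N by rewrite /T leq_divRL// mulnC.
have T0 : 0 < T%:R :> R by rewrite ltr0n; lia.
have kT : k = ((size w).+1 * T + k %% (size w).+1)%N.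
  by rewrite {1}(divn_eq k (size w).+1) mulnC.
rewrite (sum_window x k (M k) (fun v => `|blockdev w T v|)); last lia.
rewrite -/(c k).
apply: (@le_trans _ _ (wsum k (fun v =>
    T%:R * ((c k v)%:R * (I <= c k v)%:R) + I%:R * `|blockdev w T v|))).
  apply: le_wsum => v _; have := blockdev_le (R := R) b_ge2 w T v.
  move: `|_| (normr_ge0 (blockdev w T v : R)) => y y0 yT.
  case: (leqP I (c k v)) => cI /=.
    rewrite mulr1 [T%:R * _]mulrC ler_wpDr ?mulr_ge0//.
    by rewrite ler_wpM2l.
  by rewrite !mulr0 add0r ler_wpM2r// ler_nat ltnW.
rewrite wsumD !wsumZ.
have Hd : wsum k (fun v => `|blockdev w T v|) <=
    T%:R * b ^+ k * (d + (d * T%:R)^-1).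
  have := wsum_blockdev_norm (R := R) b_ge2 w T (k %% (size w).+1) d.
  by rewrite -kT; apply=> //; lia.
have dT : I%:R * (d * T%:R)^-1 <= e / 4.
  rewrite ler_pdivrMr ?mulr_gt0//.
  have : I.+1%:R / (d * (e / 4)) <= T%:R.
    by apply: ltW; rewrite (lt_le_trans (truncnS_gt _))// ler_nat.
  rewrite ler_pdivrMr ?mulr_gt0 ?divr_gt0// => HT.
  by apply: (@le_trans _ _ I.+1%:R); [rewrite ler_nat | lra].
have dI : I%:R * d <= e / 4.
  rewrite /d mulrCA ger_pMr ?divr_gt0// ler_pdivrMr ?ltr0n// mul1r.
  by rewrite ler_nat.
have TB : 0 < T%:R * b ^+ k by rewrite mulr_gt0.
have H1 : I%:R * wsum k (fun v => `|blockdev w T v|) <=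
    T%:R * b ^+ k * (e / 2).
  apply: (@le_trans _ _ (I%:R * (T%:R * b ^+ k * (d + (d * T%:R)^-1)))).
    by rewrite ler_wpM2l.
  rewrite mulrCA ler_wpM2l ?(ltW TB)// mulrDr.
  by rewrite (le_trans (lerD dI dT))//; lra.
have H2 := ler_wpM2l (ltW T0) HIk.
lra.
Unshelve. all: by end_near. Qed.

(** Summed over windows, the block deviation is [T] shifted copies of the hit sum. Each shift is at
    most [k] and so costs at most [k]; dividing by [T] gives the bound. *)
Lemma hits_near (w : seq Omega) (e : R) : 0 < e ->
  \forall k \near \oo, forall n, (n <= M k)%N ->
    `|\sum_(j < n) ((window x j (size w) == w)%:R - b ^- size w)| <=
      e * b ^+ k + k%:R.
Proof.
move=> e0; pose h j : R := (window x j (size w) == w)%:R - b ^- size w.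
near=> k => n nM.
have HS : \sum_(j < M k) `|blockdev w (k %/ (size w).+1) (window x j k)| <=
    e * (k %/ (size w).+1)%:R * b ^+ k.
  by near: k; exact: window_blockdev_small.
set T := (k %/ _)%N in HS.
have TL : ((size w).+1 * T <= k)%N by rewrite mulnC leq_divM.
have T0 : 0 < T%:R :> R.
  rewrite ltr0n divn_gt0//; near: k; by exists (size w).+1.
have HF : `|\sum_(j < n) blockdev w T (window x j k)| <= e * T%:R * b ^+ k.
  (* Absolute values inside the sum make the bound for [M k] valid for every [n <= M k]. *)
  apply: le_trans HS; apply: le_trans (ler_norm_sum _ _ _) _.
  rewrite -(big_mkord predT (fun j => `|blockdev w T (window x j k)|)).
  rewrite -(big_mkord predT (fun j => `|blockdev w T (window x j k)|)) /=.
  by rewrite (big_cat_nat _ nM)//= lerDl sumr_ge0.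
have HE : \sum_(j < n) blockdev w T (window x j k) =
    \sum_(t < T) \sum_(j < n) h (j + (size w).+1 * t)%N.
  rewrite exchange_big /=; apply: eq_bigr => j _.
  by rewrite blockdev_window.
have HD : `|\sum_(t < T) \sum_(j < n) h (j + (size w).+1 * t)%N -
    T%:R * \sum_(j < n) h j| <= T%:R * k%:R.
  rewrite -[T in T%:R * \sum_(j < n) _]card_ord mulr_natl -sumr_const -sumrB.
  apply: le_trans (ler_norm_sum _ _ _) _.
  rewrite -[T in leRHS]card_ord mulr_natl -sumr_const; apply: ler_sum => t _.
  apply: (@le_trans _ _ ((size w).+1 * t)%:R).
    apply: sum_shift_le => i j; rewrite /h ler_norml.
    by case: (_ == _); case: (_ == _) => /=; lra.
  by rewrite ler_nat; have := ltn_ord t; nia.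
rewrite -HE in HD.
rewrite -(ler_pM2l T0) -[X in X * `|_|](gtr0_norm T0) -normrM -/h.
set S := \sum_(j < n) blockdev _ _ _ in HF HD.
set H := \sum_(j < n) _; rewrite -/H in HD.
rewrite (_ : T%:R * H = S - (S - T%:R * H)); last by ring.
apply: le_trans (ler_normB _ _) _; lra.
Unshelve. all: by end_near. Qed.

(** For the least admissible [k], the hypothesis excludes [k = K], so minimality applies to its
    predecessor and yields [lambda * b ^+ (k - 1) < m]. *)
Lemma scale_exists (K m : nat) : (M K < m)%N ->
  exists k, [/\ (K <= k)%N, (m <= M k)%N & b ^+ k <= m%:R * b / lambda].
Proof.
move=> Km.
have ex : exists k, (K <= k)%N && (m <= M k)%N.
  pose C := Num.truncn (m%:R / lambda); exists (K + C.+1)%N.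
  rewrite leq_addr /M truncn_ge_nat ?(mulr_ge0 (ltW _) (ltW _))//= -ler_pdivrMl// mulrC.
  apply: le_trans (bX_ge2X _); apply: (@le_trans _ _ C.+1%:R).
    exact/ltW/truncnS_gt.
  rewrite ler_nat; apply: leq_trans (ltnW (ltn_expl _ (ltnSn 1))).
  exact: leq_addl.
case: (ex_minnP ex) => k /andP[Kk mk] kmin; exists k; split => //.
case: k => [|k] in Kk mk kmin *.
  by move: Kk mk; rewrite leqn0 => /eqP K0; rewrite K0 in Km; rewrite leqNgt Km.
have kK : (K <= k)%N.
  move: Kk; rewrite leq_eqVlt => /orP[/eqP E|//].
  by rewrite E ltnNge mk in Km.
have : (M k < m)%N.
  by rewrite ltnNge; apply/negP => mk'; have := kmin k; rewrite kK mk' ltnn => /(_ isT).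
rewrite /M truncn_lt_nat ?(mulr_ge0 (ltW _) (ltW _))// => H.
rewrite ler_pdivlMr// exprS (_ : b * _ * _ = lambda * b ^+ k * b); last by ring.
exact: ler_wpM2r (ltW b_gt0) _ _ (ltW H).
Qed.

End Deviation.

(** * Convergence of the frequencies *)

Theorem theorem2 (R : realType) (Omega : finType) (x : nat -> Omega) (lambda : R) :
  (2 <= #|Omega|)%N ->
  0 < lambda ->
  series (fun i : nat => i%:R * p_lim x lambda i) @ \oo --> (lambda : R^o) ->
  borel_normal R x.
Proof.
move=> b2 l0 ps w; set b : R := #|Omega|%:R; set q := b ^- size w.
have b0 : 0 < b by rewrite ltr0n; lia.
have q0 : 0 <= q by rewrite invr_ge0 exprn_ge0// ltW.
have q1 : q <= 1.
  by rewrite invf_le1 ?exprn_gt0// exprn_ege1// ler1n; lia.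
apply/cvgrPdist_le => /= e e0.
(* With [b ^+ k <= m%:R * b / lambda] and [m <= 2 * n], this makes [d * b ^+ k] at most
   [e / 4 * n%:R]; it is spent twice, the second time on [k]. *)
pose d := e * lambda / (8 * b).
have d0 : 0 < d by rewrite divr_gt0 ?mulr_gt0.
have [K1 _ HK1] := hits_near x lambda b2 l0 ps w d d0.
(* From [2 / d <= k] and [k * k <= 2 * b ^+ k] follows [k <= d * b ^+ k]. *)
pose K := maxn K1 (Num.truncn (2 / d)).+1.
pose N := Num.truncn ((size w).+1%:R / (e / 2)).
near=> n.
have n1 : (size w < n)%N by near: n; exists (size w).+1.
have nN : (N < n)%N by near: n; exists N.+1.
have nM : (Num.truncn (lambda * b ^+ K) + size w < n)%N.
  by near: n; exists (Num.truncn (lambda * b ^+ K) + size w).+1.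
have n0 : 0 < n%:R :> R by rewrite ltr0n (leq_ltn_trans _ n1).
have n1' : 1 <= n%:R :> R by rewrite ler1n (leq_ltn_trans _ n1).
(* The number of positions where [w] can start in the prefix of length [n]. *)
pose m := (n.+1 - size w)%N.
have mn : m%:R + (size w)%:R = n%:R + 1 :> R.
  by rewrite -natrD natr1 subnK// ltnW// ltnW.
have Km : (Num.truncn (lambda * b ^+ K) < m)%N by rewrite /m; lia.
have [k [Kk mM bk]] := scale_exists lambda b2 l0 K m Km.
have /HK1/(_ m mM) : (K1 <= k)%N by rewrite (leq_trans _ Kk)// leq_maxl.
rewrite -/b -/q in bk *.
rewrite sumrB sumr_const card_ord -natr_sum -occ_prefix -[q *+ _]mulr_natl.
set A := (occ _ _)%:R => HA.
have kd : k%:R <= d * b ^+ k.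
  have kd1 : 2 / d <= k%:R.
    apply: ltW; apply: lt_le_trans (truncnS_gt _) _; rewrite ler_nat.
    by rewrite (leq_trans _ Kk)// leq_maxr.
  have kd2 : k%:R * k%:R <= 2 * b ^+ k.
    rewrite -natrM (le_trans (_ : _ <= (2 * 2 ^ k)%:R))//.
      by rewrite ler_nat leq_sqr_exp2.
    by rewrite natrM ler_wpM2l// natrX lerXn2r ?nnegrE ?ler_nat.
  rewrite ler_pdivrMr// in kd1.
  have : 2 * k%:R <= k%:R * d * k%:R by rewrite ler_wpM2r.
  have : d * (k%:R * k%:R) <= d * (2 * b ^+ k) by rewrite ler_wpM2l// ltW.
  lra.
have HB : d * b ^+ k <= e / 4 * n%:R.
  have : d * b ^+ k <= d * (m%:R * b / lambda) by rewrite ler_wpM2l// ltW.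
  rewrite (_ : d * (m%:R * b / lambda) = e / 8 * m%:R); last first.
    by rewrite /d; field; rewrite !lt0r_neq0.
  have m2 : m%:R <= 2 * n%:R :> R.
    by have : 0 <= (size w)%:R :> R by []; lra.
  have : e / 8 * m%:R <= e / 8 * (2 * n%:R) by rewrite ler_wpM2l// divr_ge0 ?ltW.
  lra.
have HN : (size w).+1%:R <= e / 2 * n%:R.
  rewrite -ler_pdivrMl ?divr_gt0// mulrC; apply: ltW.
  by apply: lt_le_trans (truncnS_gt _) _; rewrite ler_nat.
rewrite -natr1 in HN.
have qmn : `|(m%:R - n%:R) * q| <= (size w)%:R + 1.
  rewrite normrM (ger0_norm q0) -[leRHS]mulr1 ler_pM//.
  rewrite (_ : m%:R - n%:R = 1 - (size w)%:R); last lra.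
  by rewrite ler_norml; have : 0 <= (size w)%:R :> R by []; lra.
rewrite distrC -(ler_pM2r n0) -[X in `|_| * X](gtr0_norm n0) -normrM.
rewrite mulrBl divfK ?lt0r_neq0//.
(* Deviation over the [m] positions, plus the boundary error from [m] in place of [n]; each is at
   most [e / 2 * n%:R]. *)
rewrite (_ : A - q * n%:R = (A - m%:R * q) + (m%:R - n%:R) * q); last by ring.
apply: le_trans (ler_normD _ _) _; lra.
Unshelve. all: by end_near. Qed.
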